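(* Let $\mathcal{A}=\{A_1,\ldots,A_m\}$ be a finite set of real $n\times n$ matrices, and consider the associated switched linear system $x_{k+1}=A_{\sigma(k)}x_k$ (with arbitrary switching $\sigma:\mathbb{Z}\to\{1,\ldots,m\}$) or the linear difference inclusion $x_{k+1}\in \mathrm{co}(\mathcal{A})\,x_k$. If there exist $K$ symmetric positive definite matrices $P_1,\ldots,P_K$ such that for some $\gamma>1$ $$\forall (i,k)\in\{1,\ldots,m\}\times\{1,\ldots,K\},\ \exists j\in\{1,\ldots,K\}\ \text{such that}\ \gamma^2A_i^TP_jA_i\preceq P_k,$$ then the system is absolutely asymptotically stable, i.e., $\rho(\mathcal{A})<1$. Moreover, the pointwise minimum $\min\{x^TP_1x,\ldots,x^TP_Kx\}$ of the quadratic functions is a common Lyapunov function for $\mathcal{A}$.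
   Context: The joint spectral radius is $\rho(\mathcal{A})=\lim_{k\to\infty}\max_{\sigma\in\{1,\ldots,m\}^k}\|A_{\sigma_k}\cdots A_{\sigma_1}\|^{1/k}$. $\mathrm{co}(\mathcal{A})$ is the convex hull of $\mathcal{A}$. Absolute asymptotic stability means global asymptotic stability (of the origin) for all switching sequences (respectively, for all selections in the difference inclusion); it is equivalent, for both systems, to $\rho(\mathcal{A})<1$. $P\preceq Q$ means $Q-P$ is positive semidefinite. A common Lyapunov function for $\mathcal{A}$ is a continuous, positive definite, homogeneous function $V:\mathbb{R}^n\to\mathbb{R}$ such that for some $\gamma>1$, $V(\gamma A_ix)\le V(x)$ for all $i=1,\ldots,m$ and all $x\in\mathbb{R}^n$. *)

(* Defs.v *)
From mathcomp Require Import all_boot all_order all_algebra.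
From mathcomp Require Import all_classical all_reals all_analysis.
Import Order.TTheory GRing.Theory Num.Theory.
Import numFieldNormedType.Exports.

Set Implicit Arguments.
Unset Strict Implicit.
Unset Printing Implicit Defensive.

Local Open Scope classical_set_scope.
Local Open Scope ring_scope.

Definition qform (R : realType) (n : nat) (P : 'M[R]_n) (x : 'cV[R]_n) : R :=
  (x^T *m P *m x) 0 0.

Definition posdefmx (R : realType) (n : nat) (P : 'M[R]_n) : Prop :=
  P^T = P /\ forall x : 'cV[R]_n, x != 0 -> 0 < qform P x.

Definition possemidefmx (R : realType) (n : nat) (P : 'M[R]_n) : Prop :=
  P^T = P /\ forall x : 'cV[R]_n, 0 <= qform P x.

Definition loewner_le (R : realType) (n : nat) (P Q : 'M[R]_n) : Prop :=
  possemidefmx (Q - P).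

(* The joint spectral radius does not depend on the norm, so the norm is kept
   as a parameter; it need not be submultiplicative. *)
Definition is_norm (R : realType) (n : nat) (N : 'M[R]_n -> R) : Prop :=
  [/\ forall M, 0 <= N M,
      forall M, N M = 0 -> M = 0,
      forall (a : R) M, N (a *: M) = `|a| * N M
    & forall M M', N (M + M') <= N M + N M'].

(* A finite set of matrices is given as an indexed family [A : 'I_m -> 'M_n]. *)

(* A_{s_k} ... A_{s_1}: the first letter of the word acts first, hence
   the reversal. *)
Definition word_prod (R : realType) (n m : nat) (A : 'I_m -> 'M[R]_n)
    (k : nat) (s : {ffun 'I_k -> 'I_m}) : 'M[R]_n :=
  \prod_(l < k) A (s (rev_ord l)).

Definition jsr_seq (R : realType) (n m : nat) (N : 'M[R]_n -> R)
    (A : 'I_m -> 'M[R]_n) (k : nat) : R :=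
  \big[Num.max/0]_(s : {ffun 'I_k -> 'I_m}) (N (word_prod A s) `^ (k%:R^-1)).

(* [lim] is a junk value when the sequence diverges, so use it together with
   [cvgn (jsr_seq N A)]. *)
Definition jsr (R : realType) (n m : nat) (N : 'M[R]_n -> R)
    (A : 'I_m -> 'M[R]_n) : R :=
  limn (jsr_seq N A).

Definition co (R : realType) (n m : nat) (A : 'I_m -> 'M[R]_n) :
    set 'M[R]_n :=
  [set M | exists w : 'I_m -> R, [/\ forall i, 0 <= w i,
                                     \sum_(i < m) w i = 1
                                   & M = \sum_(i < m) w i *: A i]].

Definition trajectory (R : realType) (n : nat)
    (f : int -> 'cV[R]_n -> 'cV[R]_n) (k0 : int) (x : int -> 'cV[R]_n) : Prop :=
  forall k : int, k0 <= k -> x (k + 1) = f k (x k).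

(* Lyapunov stability and global attractivity of the origin for the
   time-varying system x_{k+1} = f k x_k, from every initial time. *)
Definition globally_asymptotically_stable (R : realType) (n : nat)
    (f : int -> 'cV[R]_n -> 'cV[R]_n) : Prop :=
  forall k0 : int,
    (forall eps : R, 0 < eps -> exists2 delta : R, 0 < delta &
       forall x, trajectory f k0 x -> `|x k0| < delta ->
         forall k : int, k0 <= k -> `|x k| < eps) /\
    (forall x, trajectory f k0 x -> (fun j : nat => x (k0 + j%:Z)) @ \oo --> (0 : 'cV[R]_n)).

Definition switched_AAS (R : realType) (n m : nat) (A : 'I_m -> 'M[R]_n) :
    Prop :=
  forall sigma : int -> 'I_m,
    globally_asymptotically_stable (fun k x => A (sigma k) *m x).

(* The selections of the inclusion x_{k+1} \in co(A) x_k may depend on time and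
   on the state, so that every solution of the inclusion is a trajectory of
   one of them. *)
Definition inclusion_AAS (R : realType) (n m : nat) (A : 'I_m -> 'M[R]_n) :
    Prop :=
  forall f : int -> 'cV[R]_n -> 'cV[R]_n,
    (forall k x, [set M *m x | M in co A] (f k x)) ->
    globally_asymptotically_stable f.

(* The absolute value in the scaling factor makes norms (degree 1) and forms of
   even degree homogeneous alike. *)
Definition homogeneous_fun (R : realType) (n : nat) (V : 'cV[R]_n -> R) :
    Prop :=
  exists2 d : R, 0 < d & forall (a : R) x, V (a *: x) = (`|a| `^ d) * V x.

Definition positive_definite_fun (R : realType) (n : nat)
    (V : 'cV[R]_n -> R) : Prop :=
  V 0 = 0 /\ forall x, x != 0 -> 0 < V x.

Definition common_lyapunov (R : realType) (n m : nat) (A : 'I_m -> 'M[R]_n)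
    (V : 'cV[R]_n -> R) : Prop :=
  [/\ continuous V, positive_definite_fun V, homogeneous_fun V
    & exists2 gamma : R, 1 < gamma &
        forall i x, V ((gamma *: A i) *m x) <= V x].

(* [qform (P ord0) x] as the default value of the iterated minimum is itself
   one of the terms, hence harmless. *)
Definition min_qform (R : realType) (n K : nat) (P : 'I_K.+1 -> 'M[R]_n)
    (x : 'cV[R]_n) : R :=
  \big[Num.min/qform (P ord0) x]_(k < K.+1) qform (P k) x.

(* Main.v *)
Require Import Defs.
From mathcomp Require Import all_boot all_order all_algebra.
From mathcomp Require Import all_classical all_reals all_analysis.
Import Order.TTheory GRing.Theory Num.Theory.
Import numFieldNormedType.Exports.
Local Open Scope classical_set_scope.
Local Open Scope ring_scope.

Set Implicit Arguments.
Unset Strict Implicit.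
Unset Printing Implicit Defensive.

(** The hypothesis makes the pointwise minimum [V] of the quadratic forms
    decrease along each [A i]: if [P k] realizes [V] at [x], the form [P j]
    associated with [(i, k)] gives
    [gamma^2 V (A_i x) <= gamma^2 (A_i x)^T P_j (A_i x) <= x^T P_k x = V x].
    Being continuous, positive definite and homogeneous of degree 2, [V] is a
    common Lyapunov function ([min_qform_common_lyapunov]).

    By compactness of the unit sphere, [V] is comparable with the squared norm
    ([homogeneous_equiv]), so iterating the decrease along a word [w] yields
    [gamma^|w| |A_w x| <= D |x|] with [D] independent of [w] and [x]
    ([lyapunov_uniform_decay]). Both stability claims and the spectral bound
    follow from this uniform decay alone.

    - Difference inclusion. [V] need not be convex, hence need not decrease
      along convex combinations of the [A i]. The decay estimate, however, is an
      upper bound on norms of vectors [A_w x], and such bounds do pass to convex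
      combinations: by induction on [j], every trajectory satisfies
      [gamma^(|w| + j) |A_w x_j| <= D |x_0|] for all words [w]
      ([decay_inclusion]). The empty word gives exponential stability. Switched
      systems are particular inclusions.

    - Joint spectral radius. The maximum [u_k] of [N] over products of length
      [k] satisfies [u_(k+l) <= C u_k u_l], because all norms on matrices are
      equivalent, so [u_k^(1/k)] converges by a multiplicative form of Fekete's
      lemma ([quasi_fekete_powR]). The decay gives [u_k <= C' gamma^(-k)], so
      the limit is at most [1 / gamma]. *)

(** * Homogeneous functions and norms on matrices *)

Lemma mx_norm_le_entries (R : realType) p q (M : 'M[R]_(p, q)) (b : R) :
  0 <= b -> (forall i j, `|M i j| <= b) -> `|M| <= b.
Proof.
move=> b0 Mb; rewrite [leLHS]/Num.norm /= mx_normrE.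
by apply/bigmax_leP; split => // -[i j] _; exact: Mb.
Qed.

Lemma entry_le_mx_norm (R : realType) p q (M : 'M[R]_(p, q)) i j :
  `|M i j| <= `|M|.
Proof.
rewrite [leRHS]/Num.norm /= mx_normrE.
exact: (le_bigmax _ (fun ij => `|M ij.1 ij.2|) (i, j)).
Qed.

Lemma mx_norm_vec (R : realType) p q (u : 'rV[R]_(p * q)) :
  `|(vec_mx u : 'M[R]_(p, q))| = `|u|.
Proof.
apply/le_anti/andP; split; apply: mx_norm_le_entries => //.
  by move=> i j; rewrite mxE; exact: entry_le_mx_norm.
move=> i0 k; rewrite ord1; case/mxvec_indexP: k => i j.
by rewrite -{1}(vec_mxK u) mxvecE; exact: entry_le_mx_norm.
Qed.

Lemma vec_mx_continuous (R : realType) p q :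
  continuous (@vec_mx R p q).
Proof.
move=> u; apply/(@cvgrPdist_le _ _ _ (nbhs u)) => e e0; near=> v.
rewrite -linearB mx_norm_vec; near: v.
by apply: cvgr_dist_le e0; exact: cvg_id.
Unshelve. all: by end_near. Qed.

(** Heine-Borel for row vectors, transported through the isometry [vec_mx]. *)
Lemma mx_sphere_compact (R : realType) p q :
  compact [set M : 'M[R]_(p, q) | `|M| = 1].
Proof.
have -> : [set M : 'M[R]_(p, q) | `|M| = 1] =
    vec_mx @` [set u : 'rV[R]_(p * q) | `|u| = 1].
  apply/seteqP; split => [M /= M1|_ /= [u u1 <-]]; last by rewrite mx_norm_vec.
  by exists (mxvec M); rewrite ?mxvecK//= -mx_norm_vec mxvecK.
apply: continuous_compact.
  by apply: continuous_subspaceT; exact: vec_mx_continuous.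
apply: bounded_closed_compact.
  exists 1; split; first exact: num_real.
  by move=> x x1 u /= ->; exact: ltW.
have -> : [set u : 'rV[R]_(p * q) | `|u| = 1] =
    Num.norm @^-1` [set x : R | x = 1] by [].
apply: preimage_closed; last exact: closed_eq.
by move=> u _; exact: norm_continuous.
Qed.

(** The constants are the extrema of [f] on the unit sphere. A
    positive degree forces [f 0 = 0], so that the bounds also hold at the
    origin, which no rescaling brings to the sphere. *)
Lemma homogeneous_equiv (R : realType) p q d (f : 'M[R]_(p, q) -> R) :
  continuous f -> (forall x, x != 0 -> 0 < f x) ->
  (forall (a : R) x, f (a *: x) = `|a| ^+ d.+1 * f x) ->
  exists c C, [/\ 0 < c, 0 < C &
    forall x, c * `|x| ^+ d.+1 <= f x <= C * `|x| ^+ d.+1].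
Proof.
move=> fc fpos fhom.
have f0 : f 0 = 0 by rewrite -(scale0r 0) fhom normr0 expr0n mul0r.
set S := [set x : 'M[R]_(p, q) | `|x| = 1].
(* The sphere is empty exactly when the matrices have no entry. *)
have [S0|S0] := eqVneq S set0.
  have x0 (x : 'M[R]_(p, q)) : x = 0.
    apply/eqP; apply: contraT => xn0.
    suff : S (`|x|^-1 *: x) by rewrite S0.
    by rewrite /S/= normrZ normfV normr_id mulVf// normr_eq0.
  exists 1, 1; split=> // x; rewrite (x0 x) f0 normr0 expr0n mulr0 lexx//.
move/set0P : S0 => S0.
have fS : {within S, continuous f} by exact: continuous_subspaceT.
have cS : compact S := @mx_sphere_compact R p q.
have [a /set_mem aS fa] := compact_EVT_min S0 cS fS.
have [b /set_mem bS fb] := compact_EVT_max S0 cS fS.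
have nS x : S x -> 0 < f x.
  by move=> Sx; apply: fpos; rewrite -normr_eq0 Sx oner_eq0.
exists (f a), (f b); split; [exact: nS|exact: nS|] => x.
have [->|xn0] := eqVneq x 0; first by rewrite f0 normr0 expr0n !mulr0 lexx.
have n0 : 0 < `|x| by rewrite normr_gt0.
have Sx : `|x|^-1 *: x \in S.
  by rewrite inE /S/= normrZ normfV normr_id mulVf// gt_eqF.
have -> : f x = f (`|x|^-1 *: x) * `|x| ^+ d.+1.
  by rewrite fhom normfV normr_id mulrAC -exprMn mulVf ?expr1n ?mul1r// gt_eqF.
by rewrite !ler_pM2r ?exprn_gt0// fa// fb.
Qed.

Lemma mulmx_norm_le (R : realType) p q r (X : 'M[R]_(p, q)) (Y : 'M[R]_(q, r)) :
  `|X *m Y| <= q%:R * (`|X| * `|Y|).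
Proof.
apply: mx_norm_le_entries => [|i j]; first by rewrite !mulr_ge0.
rewrite mxE (le_trans (ler_norm_sum _ _ _))//.
rewrite -[q in q%:R]card_ord mulr_natl -sumr_const ler_sum// => k _.
by rewrite normrM ler_pM// entry_le_mx_norm.
Qed.

(** The entries of [M] are read off its values on the standard basis, whose
    vectors have sup norm at most 1. *)
Lemma operator_bound (R : realType) p q (M : 'M[R]_(p, q)) (b : R) :
  0 <= b -> (forall x : 'cV[R]_q, `|M *m x| <= b * `|x|) -> `|M| <= b.
Proof.
move=> b0 Mb; apply: mx_norm_le_entries => // i j.
have -> : M i j = (M *m (delta_mx j 0 : 'cV_q)) i 0 by rewrite -colE mxE.
rewrite (le_trans (entry_le_mx_norm _ _ _))// (le_trans (Mb _))// ler_piMr//.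
by apply: mx_norm_le_entries => // k l; rewrite mxE normr_nat lern1 leq_b1.
Qed.

Lemma is_norm_sum (R : realType) n (N : 'M[R]_n -> R) : is_norm N ->
  forall (I : Type) (r : seq I) F,
  N (\sum_(i <- r) F i) <= \sum_(i <- r) N (F i).
Proof.
move=> [_ _ NZ ND] I r F; elim/big_ind2 : _ => //.
  by rewrite -(scale0r 0) NZ normr0 mul0r.
by move=> x a y b xa yb; rewrite (le_trans (ND _ _))// lerD.
Qed.

(** Expand a matrix in the basis of elementary matrices. *)
Lemma is_norm_le (R : realType) n (N : 'M[R]_n -> R) : is_norm N ->
  exists2 C, 0 < C & forall M, N M <= C * `|M|.
Proof.
move=> Nn; have [N0 _ NZ ND] := Nn.
exists (1 + \sum_(i < n) \sum_(j < n) N (delta_mx i j)).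
  by rewrite ltr_pwDl// sumr_ge0// => i _; rewrite sumr_ge0.
move=> M; rewrite {1}(matrix_sum_delta M) (le_trans (is_norm_sum Nn _ _))//.
rewrite mulrDl mul1r -[leLHS]add0r lerD// mulr_suml ler_sum// => i _.
rewrite (le_trans (is_norm_sum Nn _ _))// mulr_suml ler_sum// => j _.
by rewrite NZ mulrC ler_wpM2l// entry_le_mx_norm.
Qed.

Lemma is_norm_continuous (R : realType) n (N : 'M[R]_n -> R) : is_norm N ->
  continuous N.
Proof.
move=> Nn; have [N0 _ NZ ND] := Nn; have [C C0 NC] := is_norm_le Nn.
have NN M : N (- M) = N M by rewrite -scaleN1r NZ normrN1 mul1r.
have NB X Y : N X - N Y <= N (X - Y) by rewrite lerBlDr -{1}(subrK Y X).
move=> M; apply/(@cvgrPdist_le _ _ _ (nbhs M)) => e e0; near=> M'.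
have : `|N M - N M'| <= N (M - M').
  by rewrite ler_norml lerNl opprB NB -(NN (M - M')) opprB NB.
move=> /le_trans; apply; rewrite (le_trans (NC _))// mulrC -ler_pdivlMr//.
near: M'; by apply: cvgr_dist_le; [exact: cvg_id|exact: divr_gt0].
Unshelve. all: by end_near. Qed.

Lemma is_norm_equiv (R : realType) n (N : 'M[R]_n -> R) : is_norm N ->
  exists c C, [/\ 0 < c, 0 < C & forall M, c * `|M| <= N M <= C * `|M|].
Proof.
move=> Nn; have [N0 Neq0 NZ ND] := Nn.
have /(_ 0)[|a M|c [C [c0 C0 H]]] := homogeneous_equiv (is_norm_continuous Nn).
- move=> x x0; rewrite lt_neqAle N0 andbT eq_sym; apply: contra x0 => /eqP.
  by move=> /Neq0 ->.
- by rewrite NZ expr1.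
- by exists c, C; split.
Qed.

(** Compare with the sup norm, which is submultiplicative up to a dimensional
    factor. *)
Lemma is_norm_quasi_submul (R : realType) n (N : 'M[R]_n -> R) : is_norm N ->
  exists2 C, 0 < C & forall X Y, N (X *m Y) <= C * (N X * N Y).
Proof.
move=> Nn; have [c [C [c0 C0 H]]] := is_norm_equiv Nn.
have b0 : 0 < c^-1 by rewrite invr_gt0.
have Nb X : `|X| <= c^-1 * N X.
  by rewrite ler_pdivlMl//; have /andP[] := H X.
(* [n.+1] instead of [n] keeps the constant positive in dimension 0. *)
exists (C * (n.+1%:R * (c^-1 * c^-1))); first by rewrite !mulr_gt0.
move=> X Y; have /andP[_ /le_trans] := H (X *m Y); apply.
rewrite -!mulrA ler_pM2l// (le_trans (mulmx_norm_le X Y))//.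
have -> : c^-1 * (c^-1 * (N X * N Y)) = (c^-1 * N X) * (c^-1 * N Y).
  by rewrite mulrACA mulrA.
by rewrite ler_pM// ?mulr_ge0// ?ler_nat// ler_pM.
Qed.

(** * A multiplicative Fekete lemma *)

Lemma cvg_root (R : realType) (M : R) : 0 < M ->
  (M `^ k%:R^-1) @[k --> \oo] --> (1 : R).
Proof.
move=> M0.
have -> : (fun k : nat => M `^ k%:R^-1) =
    (fun k : nat => expR (k%:R^-1 * ln M)).
  by apply/funext => k; rewrite /powR gt_eqF.
suff : (fun k : nat => expR (k%:R^-1 * ln M)) @ \oo --> expR (0 * ln M).
  by rewrite mul0r expR0.
apply: continuous_cvg; first exact: continuous_expR.
apply: cvgMr_tmp.
rewrite -(cvg_shiftn 1%N) /=.
apply: cvg_trans (@cvg_harmonic R); apply: near_eq_cvg.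
by near=> k; rewrite /= addn1.
Unshelve. all: by end_near. Qed.

(** The limit is the infimum [L] of [b_k^(1/k)] over [k > 0]. If
    [b_p^(1/p) < r], then Euclidean division of [k] by [p] gives
    [b_k <= r^k M] with [M] independent of [k], and [M^(1/k)] tends to 1.
    Working with powers rather than logarithms covers sequences that vanish,
    which occur for nilpotent families. *)
Lemma fekete_powR (R : realType) (b : nat -> R) :
  (forall k, 0 <= b k) -> (forall k l, b (k + l)%N <= b k * b l) ->
  cvgn (fun k => b k `^ k%:R^-1).
Proof.
move=> b0 bM.
have root_exp (x : R) k : 0 <= x -> (0 < k)%N -> (x ^+ k) `^ k%:R^-1 = x.
  move=> x0 k0; rewrite -powR_mulrn// -powRrM divff ?powRr1//.
  by rewrite pnatr_eq0 -lt0n.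
have exp_root (x : R) k : 0 <= x -> (0 < k)%N -> (x `^ k%:R^-1) ^+ k = x.
  move=> x0 k0; rewrite -powR_mulrn ?powR_ge0// -powRrM mulVf ?powRr1//.
  by rewrite pnatr_eq0 -lt0n.
pose S := [set b k `^ k%:R^-1 | k in [set k | (0 < k)%N]].
have infS : has_inf S.
  split; first by exists (b 1%N `^ 1%:R^-1), 1%N.
  by exists 0 => _ [k _ <-]; exact: powR_ge0.
pose L := inf S.
have L0 : 0 <= L.
  by apply: lb_le_inf => [|_ [k _ <-]]; [case: infS|exact: powR_ge0].
have LS k : (0 < k)%N -> L <= b k `^ k%:R^-1.
  by move=> k0; apply: ge_inf; [case: infS|exists k].
apply/cvg_ex; exists L; apply/cvgrPdist_le => e e0.
pose r := L + e / 2.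
have r0 : 0 < r by rewrite ltr_wpDl// divr_gt0.
have [_ [p p0 <-] pr] : exists2 x, S x & x < r.
  by apply: inf_adherent => //; rewrite divr_gt0.
have bpr : b p <= r ^+ p.
  by rewrite -(exp_root (b p) p)// lerXn2r ?nnegrE ?powR_ge0 ?ltW.
have bq q t : b (q * p + t)%N <= r ^+ (q * p) * b t.
  elim: q => [|q IH]; first by rewrite expr0 mul1r.
  rewrite mulSn -addnA (le_trans (bM _ _))// exprD -mulrA.
  by rewrite ler_pM.
pose B := 1 + \sum_(t < p) b t.
have B0 : 0 < B by rewrite ltr_pwDl// sumr_ge0.
have bB t : (t < p)%N -> b t <= B.
  move=> tp; rewrite /B (bigD1 (Ordinal tp))//= addrCA lerDl.
  by rewrite addr_ge0// sumr_ge0.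
(* The remainder [k %% p] costs a factor [B] for [b] and at most
   [(1 + r^-1)^p] for replacing [r ^+ (k - k %% p)] by [r ^+ k]. *)
pose M := B * (1 + r^-1) ^+ p.
have r1 : 1 <= 1 + r^-1 by rewrite lerDl invr_ge0 ltW.
have M0 : 0 < M by rewrite mulr_gt0// exprn_gt0// (lt_le_trans _ r1).
have bM' k : b k <= r ^+ k * M.
  have tp : (k %% p < p)%N by rewrite ltn_mod.
  rewrite {1 2}(divn_eq k p) (le_trans (bq _ _))// exprD -mulrA.
  rewrite ler_pM2l ?exprn_gt0// /M mulrCA (le_trans (bB _ tp))//.
  rewrite ler_peMr ?(ltW B0)//.
  have : 1 <= (r * (1 + r^-1)) ^+ (k %% p).
    by rewrite exprn_ege1// mulrDr divff ?gt_eqF// mulr1 lerDr ltW.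
  move=> /le_trans; apply; rewrite exprMn ler_pM2l ?exprn_gt0//.
  by rewrite ler_weXn2l// ltnW.
have cM : (r * M `^ k%:R^-1) @[k --> \oo] --> r * 1.
  by apply: cvgMl_tmp; exact: cvg_root.
have rL : r * 1 < L + e by rewrite mulr1 ltrD2l ltr_pdivrMr// ltr_pMr// ltr1n.
have rMe : \forall k \near \oo, r * M `^ k%:R^-1 <= L + e.
  exact: cvgr_le cM _ rL.
near=> k.
have k0 : (0 < k)%N by near: k; exact: nbhs_infty_gt.
rewrite distrC ger0_norm ?subr_ge0 ?LS// lerBlDl.
apply: (@le_trans _ _ (r * M `^ k%:R^-1)).
  rewrite -{1}(root_exp r k (ltW r0) k0).
  rewrite -powRM ?exprn_ge0 ?(ltW r0) ?(ltW M0)//.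
  by rewrite ge0_ler_powR ?invr_ge0 ?nnegrE// (le_trans (b0 k) (bM' k)).
by near: k; exact: rMe.
Unshelve. all: by end_near. Qed.

(** The sequence [C u] is submultiplicative, and [C^(1/k)] tends to 1. *)
Lemma quasi_fekete_powR (R : realType) (C : R) (u : nat -> R) :
  0 < C -> (forall k, 0 <= u k) ->
  (forall k l, u (k + l)%N <= C * (u k * u l)) ->
  cvgn (fun k => u k `^ k%:R^-1).
Proof.
move=> C0 u0 uM.
have cC : cvgn (fun k => C^-1 `^ k%:R^-1).
  by apply/cvg_ex; exists 1; apply: cvg_root; rewrite invr_gt0.
have cb : cvgn (fun k => (C * u k) `^ k%:R^-1).
  apply: (@fekete_powR R (fun k => C * u k)) => [k|k l].
    by rewrite mulr_ge0// ltW.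
  by rewrite -mulrA ler_pM2l// (le_trans (uM k l))// mulrCA.
have -> : (fun k => u k `^ k%:R^-1) =
   (fun k : nat => C^-1 `^ k%:R^-1 * (C * u k) `^ k%:R^-1).
  apply/funext => k; rewrite -powRM ?invr_ge0 ?mulr_ge0 ?(ltW C0)//.
  by rewrite mulKf// gt_eqF.
exact: is_cvgM cC cb.
Qed.

(** * The minimum of quadratic forms as a Lyapunov function *)

Lemma qform0 (R : realType) n (P : 'M[R]_n) : qform P 0 = 0.
Proof. by rewrite /qform mulmx0 mxE. Qed.

Lemma qformZ (R : realType) n (P : 'M[R]_n) (a : R) x :
  qform P (a *: x) = a ^+ 2 * qform P x.
Proof.
rewrite /qform -scalemxAr [(a *: x)^T]linearZ/= -!scalemxAl !mxE.
by rewrite mulrA expr2.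
Qed.

Lemma qformE (R : realType) n (P : 'M[R]_n) x :
  qform P x = \sum_j (\sum_i x i 0 * P i j) * x j 0.
Proof.
rewrite /qform mxE; apply: eq_bigr => j _; rewrite mxE; congr (_ * _).
by apply: eq_bigr => i _; rewrite mxE.
Qed.

Lemma sum_continuous (R : realType) (T : topologicalType) (I : Type)
    (r : seq I) (F : I -> T -> R) :
  (forall i, continuous (F i)) -> continuous (fun x => \sum_(i <- r) F i x).
Proof.
move=> Fc; elim: r => [|i r IH].
  by under eq_fun do rewrite big_nil; move=> x; exact: cvg_cst.
under eq_fun do rewrite big_cons.
by move=> x; apply: cvgD; [exact: Fc|exact: IH].
Qed.

Lemma qform_continuous (R : realType) n (P : 'M[R]_n) : continuous (qform P).
Proof.
have -> : qform P = fun x => \sum_j (\sum_i x i 0 * P i j) * x j 0.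
  by apply/funext => x; exact: qformE.
have co (i : 'I_n) : continuous (fun x : 'cV[R]_n => x i 0).
  exact: coord_continuous.
have row j : continuous (fun x : 'cV[R]_n => \sum_i x i 0 * P i j).
  by apply: sum_continuous => i x; exact: (cvgM (co i x) (cvg_cst _)).
by apply: sum_continuous => j x; exact: (cvgM (row j x) (co j x)).
Qed.

Lemma loewner_qform (R : realType) n (A P Q : 'M[R]_n) (g : R) :
  loewner_le (g ^+ 2 *: (A^T *m P *m A)) Q ->
  forall x, g ^+ 2 * qform P (A *m x) <= qform Q x.
Proof.
move=> [_ H] x; move: (H x); rewrite /qform.
have entry (X Y : 'M[R]_1) a : (X - a *: Y) 0 0 = X 0 0 - a * Y 0 0.
  by rewrite !mxE.
rewrite mulmxBr mulmxBl -scalemxAr -scalemxAl entry subr_ge0.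
by rewrite trmx_mul !mulmxA.
Qed.

Section MinQform.
Context {R : realType} {n K : nat} (P : 'I_K.+1 -> 'M[R]_n).
Local Notation V := (min_qform P).

Lemma min_qform_le k x : V x <= qform (P k) x.
Proof. exact: bigmin_le. Qed.

Lemma min_qform_attained x : exists k, V x = qform (P k) x.
Proof.
rewrite /min_qform; elim/big_ind: _ => [|a b [i ->] [j ->]|i _].
- by exists ord0.
- by rewrite minEle; case: ifP => _; [exists i|exists j].
- by exists i.
Qed.

Lemma min_qformZ (a : R) x : V (a *: x) = `|a| ^+ 2 * V x.
Proof.
rewrite real_normK ?num_real//.
have [k Vk] := min_qform_attained x; have [j Vj] := min_qform_attained (a *: x).
apply/le_anti/andP; split; first by rewrite Vk -qformZ min_qform_le.
by rewrite Vj qformZ ler_wpM2l ?sqr_ge0// min_qform_le.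
Qed.

Lemma min_qform_continuous : continuous V.
Proof.
rewrite /min_qform; elim: (index_enum _) => [|k r IH].
  under eq_fun do rewrite big_nil; exact: qform_continuous.
under eq_fun do rewrite big_cons.
by move=> x; apply: continuous_min; [exact: qform_continuous|exact: IH].
Qed.

Hypothesis Ppos : forall k, posdefmx (P k).

Lemma min_qform_posdef : positive_definite_fun V.
Proof.
split; first by have [k ->] := min_qform_attained 0; rewrite qform0.
by move=> x x0; have [k ->] := min_qform_attained x; exact: (Ppos k).2.
Qed.

(** The form [P j] paired with a form [P k] realizing the minimum at [x] bounds
    the minimum at [A x]. *)
Lemma min_qform_decrease (A : 'M[R]_n) (g : R) :
  (forall k, exists j, loewner_le (g ^+ 2 *: (A^T *m P j *m A)) (P k)) ->
  forall x, g ^+ 2 * V (A *m x) <= V x.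
Proof.
move=> H x; have [k ->] := min_qform_attained x; have [j Hj] := H k.
apply: le_trans (loewner_qform Hj x); rewrite ler_wpM2l ?sqr_ge0//.
exact: min_qform_le.
Qed.

Lemma min_qform_equiv : exists c C, [/\ 0 < c, 0 < C &
  forall x, c * `|x| ^+ 2 <= V x <= C * `|x| ^+ 2].
Proof.
apply: homogeneous_equiv; first exact: min_qform_continuous.
  by case: min_qform_posdef.
exact: min_qformZ.
Qed.

End MinQform.

Lemma min_qform_common_lyapunov (R : realType) (n m K : nat)
    (A : 'I_m -> 'M[R]_n) (P : 'I_K.+1 -> 'M[R]_n) (g : R) :
  (forall k, posdefmx (P k)) -> 1 < g ->
  (forall i k, exists j,
    loewner_le (g ^+ 2 *: ((A i)^T *m P j *m A i)) (P k)) ->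
  common_lyapunov A (min_qform P).
Proof.
move=> Ppos g1 H; split.
- exact: min_qform_continuous.
- exact: min_qform_posdef.
- by exists 2%:R => // a x; rewrite powR_mulrn// min_qformZ.
- exists g => // i x; rewrite -scalemxAl min_qformZ real_normK ?num_real//.
  exact: min_qform_decrease.
Qed.

(** * Uniform decay and stability of trajectories *)

(** Stated on vectors rather than on matrix norms, so that it passes to convex
    combinations and involves no submultiplicativity constant. *)
Definition uniform_decay (R : realType) (n m : nat) (A : 'I_m -> 'M[R]_n)
    (g D : R) :=
  forall (w : seq 'I_m) (x : 'cV[R]_n),
    g ^+ size w * `|(\prod_(i <- w) A i) *m x| <= D * `|x|.

Lemma lyapunov_uniform_decay (R : realType) (n m : nat) (A : 'I_m -> 'M[R]_n)
    (V : 'cV[R]_n -> R) (g c C : R) :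
  0 < g -> 0 < c -> 0 < C ->
  (forall x, c * `|x| ^+ 2 <= V x <= C * `|x| ^+ 2) ->
  (forall i x, g ^+ 2 * V (A i *m x) <= V x) ->
  uniform_decay A g (Num.sqrt (C / c)).
Proof.
move=> g0 c0 C0 Veq VA.
have Vw w x : (g ^+ size w) ^+ 2 * V ((\prod_(i <- w) A i) *m x) <= V x.
  elim: w => [|i w IH]; first by rewrite big_nil mul1mx expr1n mul1r.
  apply: le_trans IH; rewrite big_cons -mulmxA [g ^+ _]exprS exprMn.
  rewrite mulrAC mulrC.
  by rewrite ler_pM2l ?exprn_gt0// VA.
move=> w x.
rewrite -(@ler_pXn2r _ 2)// ?nnegrE ?mulr_ge0 ?exprn_ge0 ?sqrtr_ge0 ?(ltW g0)//.
rewrite !exprMn sqr_sqrtr ?divr_ge0 ?(ltW C0) ?(ltW c0)//.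
rewrite [leRHS]mulrAC ler_pdivlMr// mulrC mulrCA.
apply: le_trans (le_trans (Vw w x) (andP (Veq x)).2).
by rewrite ler_pM2l ?exprn_gt0// ?exprn_gt0// (andP (Veq _)).1.
Qed.

(** An arbitrary word in front of the current state makes the induction close:
    the next state is a convex combination of the [A i x_j], so a word [w]
    applied to it is the same combination of the words [w i] applied to
    [x_j]. *)
Lemma decay_inclusion (R : realType) (n m : nat) (A : 'I_m -> 'M[R]_n)
    (g D : R) : 0 < g -> uniform_decay A g D ->
  forall (f : int -> 'cV[R]_n -> 'cV[R]_n) k0 x,
  (forall k x, [set M *m x | M in co A] (f k x)) ->
  trajectory f k0 x ->
  forall j : nat, g ^+ j * `|x (k0 + j%:Z)| <= D * `|x k0|.
Proof.
move=> g0 dec f k0 x fA tx j.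
suff H (w : seq 'I_m) :
    g ^+ (size w + j) * `|(\prod_(i <- w) A i) *m x (k0 + j%:Z)| <= D * `|x k0|.
  by have := H [::]; rewrite big_nil mul1mx.
elim: j w => [|j IH] w; first by rewrite addn0 addr0; exact: dec.
have -> : x (k0 + j.+1%:Z) = f (k0 + j%:Z) (x (k0 + j%:Z)).
  by rewrite -tx ?lerDl// -addrA -PoszD addn1.
have [M [a [a0 a1 ->]] <-] := fA (k0 + j%:Z) (x (k0 + j%:Z)).
set y := x (k0 + j%:Z).
have -> : (\prod_(i <- w) A i) *m ((\sum_i a i *: A i) *m y) =
    \sum_i a i *: ((\prod_(l <- rcons w i) A l) *m y).
  rewrite mulmx_suml mulmx_sumr; apply: eq_bigr => i _.
  by rewrite -cats1 big_cat big_seq1 -scalemxAl -scalemxAr mulmxA.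
rewrite -[leRHS]mul1r -a1 mulr_suml.
apply: (@le_trans _ _ (g ^+ (size w + j.+1) *
    \sum_i a i * `|(\prod_(l <- rcons w i) A l) *m y|)).
  rewrite ler_wpM2l ?exprn_ge0 ?(ltW g0)// (le_trans (ler_norm_sum _ _ _))//.
  by apply: ler_sum => i _; rewrite normrZ ger0_norm.
rewrite mulr_sumr; apply: ler_sum => i _; rewrite mulrCA ler_wpM2l//.
by have := IH (rcons w i); rewrite size_rcons addSnnS.
Qed.

(** The distance to the origin is at most [D g^(-j)] times the initial one. *)
Lemma decay_inclusion_AAS (R : realType) (n m : nat) (A : 'I_m -> 'M[R]_n)
    (g D : R) : 1 < g -> 0 < D -> uniform_decay A g D -> inclusion_AAS A.
Proof.
move=> g1 D0 dec f fA k0; have g0 : 0 < g by exact: lt_trans g1.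
have H x (tx : trajectory f k0 x) := decay_inclusion g0 dec fA tx.
split=> [e e0|x tx].
  exists (e / D); first exact: divr_gt0.
  move=> x tx xe k k0k.
  have -> : k = k0 + `|k - k0|%N%:Z.
    by rewrite gez0_abs ?subr_ge0// subrKC.
  move: (`|k - k0|%N) => j.
  apply: (@le_lt_trans _ _ (D * `|x k0|)); last by rewrite mulrC -ltr_pdivlMr.
  by apply: le_trans (H x tx j); rewrite ler_peMl// exprn_ege1// ltW.
apply/cvgr0Pnorm_le => e e0.
have cg : (fun j => D * `|x k0| * g^-1 ^+ j) @ \oo --> D * `|x k0| * 0.
  apply: cvgMl_tmp; apply: cvg_expr.
  by rewrite ger0_norm ?invr_ge0 ?(ltW g0)// invf_lt1.
near=> j; apply: (@le_trans _ _ (D * `|x k0| * g^-1 ^+ j)).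
  by rewrite exprVn ler_pdivlMr ?exprn_gt0// mulrC H.
near: j; apply: (cvgr_le _ cg); rewrite mulr0//.
Unshelve. all: by end_near. Qed.

(** Each matrix of the family lies in its convex hull, with a unit weight. *)
Lemma inclusion_AAS_switched (R : realType) (n m : nat) (A : 'I_m -> 'M[R]_n) :
  inclusion_AAS A -> switched_AAS A.
Proof.
move=> H sigma; apply: H => k x; exists (A (sigma k)) => //.
exists (fun i => (i == sigma k)%:R); split => [i||].
- by rewrite ler0n.
- by rewrite (bigD1 (sigma k))//= eqxx big1 ?addr0// => i /negPf ->.
- rewrite (bigD1 (sigma k))//= eqxx scale1r big1 ?addr0// => i /negPf ->.
  by rewrite scale0r.
Qed.

(** * Uniform decay and the joint spectral radius *)

Definition word_growth (R : realType) (n m : nat) (N : 'M[R]_n -> R)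
    (A : 'I_m -> 'M[R]_n) (k : nat) : R :=
  \big[Num.max/0]_(s : {ffun 'I_k -> 'I_m}) N (word_prod A s).

(** Taking a root is monotone, so it commutes with the maximum. The family is
    nonempty, which ensures that the maximum is attained by some word: this
    matters for [k = 0], where the exponent is 0 and a root does not fix the
    default value 0. *)
Lemma jsr_seqE (R : realType) (n m : nat) (N : 'M[R]_n -> R)
    (A : 'I_m.+1 -> 'M[R]_n) : (forall M, 0 <= N M) ->
  jsr_seq N A = fun k => word_growth N A k `^ k%:R^-1.
Proof.
move=> N0; apply/funext => k; apply/le_anti/andP; split.
  apply: bigmax_le => [|s _]; first exact: powR_ge0.
  by rewrite ge0_ler_powR ?invr_ge0 ?nnegrE ?bigmax_ge_id//; exact: le_bigmax.
(* Any word serves as the witness that words of length [k] exist. *)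
have [s _ e] := @eq_bigmax _ _ _ 0 [ffun=> ord0] xpredT
  (fun s : {ffun 'I_k -> 'I_m.+1} => N (word_prod A s)) isT (fun s _ => N0 _).
rewrite /word_growth e.
exact: (le_bigmax _ (fun s => N (word_prod A s) `^ k%:R^-1)).
Qed.

(** The letters acting last come first in the product, so the first factor
    carries the final [k] letters of the word. *)
Lemma word_prod_split (R : realType) (n m : nat) (A : 'I_m -> 'M[R]_n) k l
    (s : {ffun 'I_(k + l) -> 'I_m}) : exists s1 s2,
  word_prod A s = word_prod A (s1 : {ffun 'I_k -> 'I_m}) *m
                  word_prod A (s2 : {ffun 'I_l -> 'I_m}).
Proof.
exists [ffun i => s (rev_ord (lshift l (rev_ord i)))].
exists [ffun i => s (rev_ord (rshift k (rev_ord i)))].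
rewrite /word_prod big_split_ord/=.
by congr (_ *m _); apply: eq_bigr => i _; rewrite ffunE rev_ordK.
Qed.

Lemma word_growth_quasi_submul (R : realType) (n m : nat) (N : 'M[R]_n -> R)
    (A : 'I_m -> 'M[R]_n) (C : R) : 0 < C -> (forall M, 0 <= N M) ->
  (forall X Y, N (X *m Y) <= C * (N X * N Y)) ->
  forall k l,
  word_growth N A (k + l) <= C * (word_growth N A k * word_growth N A l).
Proof.
move=> C0 N0 NM k l.
have G0 j : 0 <= word_growth N A j by exact: bigmax_ge_id.
apply: bigmax_le => [|s _]; first by rewrite !mulr_ge0// ltW.
have [s1 [s2 ->]] := word_prod_split A s.
rewrite (le_trans (NM _ _))// ler_pM2l// ler_pM//.
  exact: (le_bigmax _ (fun s => N (word_prod A s))).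
exact: (le_bigmax _ (fun s => N (word_prod A s))).
Qed.

Lemma decay_word_growth (R : realType) (n m : nat) (N : 'M[R]_n -> R)
    (A : 'I_m -> 'M[R]_n) (g D C : R) :
  0 < g -> 0 < C -> 0 < D -> (forall M, N M <= C * `|M|) ->
  uniform_decay A g D -> forall k, word_growth N A k <= C * D * g^-1 ^+ k.
Proof.
move=> g0 C0 D0 NC dec k.
have gk : 0 <= D * g^-1 ^+ k by rewrite mulr_ge0 ?exprn_ge0 ?invr_ge0 ?ltW.
rewrite -mulrA; apply: bigmax_le => [|s _]; first by rewrite mulr_ge0 ?(ltW C0).
rewrite (le_trans (NC _))// ler_pM2l//; apply: operator_bound => // x.
pose w := [seq s (rev_ord i) | i <- index_enum 'I_k].
have -> : word_prod A s = \prod_(i <- w) A i by rewrite big_map.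
have := dec w x; rewrite size_map [index_enum _]unlock -enumT size_enum_ord.
by rewrite exprVn mulrAC ler_pdivlMr ?exprn_gt0// mulrC.
Qed.

Lemma decay_jsr (R : realType) (n m : nat) (N : 'M[R]_n -> R)
    (A : 'I_m.+1 -> 'M[R]_n) (g D : R) :
  is_norm N -> 1 < g -> 0 < D -> uniform_decay A g D ->
  cvgn (jsr_seq N A) /\ jsr N A < 1.
Proof.
move=> Nn g1 D0 dec; have [N0 _ _ _] := Nn.
have g0 : 0 < g by exact: lt_trans g1.
have [C C0 NM] := is_norm_quasi_submul Nn.
have cJ : cvgn (jsr_seq N A).
  rewrite jsr_seqE//; apply: (quasi_fekete_powR C0) => [k|].
    exact: bigmax_ge_id.
  exact: word_growth_quasi_submul.
split => //; apply: (@le_lt_trans _ _ g^-1); last by rewrite invf_lt1.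
have [B B0 NB] := is_norm_le Nn.
have BD0 : 0 < B * D by exact: mulr_gt0.
have cg : (fun k : nat => (B * D) `^ k%:R^-1 * g^-1) @ \oo --> 1 * g^-1.
  by apply: cvgMr_tmp; exact: cvg_root.
rewrite -[leRHS]mul1r; apply: ler_cvg_to cJ cg _.
near=> k.
have k0 : (0 < k)%N by near: k; exact: nbhs_infty_gt.
have gV0 : 0 <= g^-1 by rewrite invr_ge0 ltW.
rewrite jsr_seqE//.
have -> : (B * D) `^ k%:R^-1 * g^-1 = (B * D * g^-1 ^+ k) `^ k%:R^-1.
  rewrite [RHS]powRM ?exprn_ge0 ?(ltW BD0)//; congr (_ * _).
  by rewrite -powR_mulrn// -powRrM divff ?powRr1// pnatr_eq0 -lt0n.
rewrite ge0_ler_powR ?invr_ge0 ?nnegrE ?mulr_ge0 ?exprn_ge0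
  ?(ltW B0) ?(ltW D0)//.
  exact: bigmax_ge_id.
exact: decay_word_growth.
Unshelve. all: by end_near. Qed.

(** * Stability from several quadratic forms *)

Theorem corollary3p4 (R : realType) (n m K : nat)
  (N : 'M[R]_n -> R) (A : 'I_m.+1 -> 'M[R]_n) (P : 'I_K.+1 -> 'M[R]_n)
  (gamma : R) :
  is_norm N ->
  (forall k, posdefmx (P k)) ->
  1 < gamma ->
  (forall (i : 'I_m.+1) (k : 'I_K.+1), exists j : 'I_K.+1,
     loewner_le (gamma ^+ 2 *: ((A i)^T *m P j *m A i)) (P k)) ->
  [/\ switched_AAS A,
      inclusion_AAS A,
      cvgn (jsr_seq N A) /\ jsr N A < 1
    & common_lyapunov A (min_qform P)].
Proof.
move=> Nn Ppos g1 PA.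
have [c [C [c0 C0 VcC]]] := min_qform_equiv Ppos.
have D0 : 0 < Num.sqrt (C / c) by rewrite sqrtr_gt0 divr_gt0.
have dec : uniform_decay A gamma (Num.sqrt (C / c)).
  apply: lyapunov_uniform_decay VcC _ => // [|i]; first exact: lt_trans g1.
  exact: min_qform_decrease.
have incl := decay_inclusion_AAS g1 D0 dec.
split=> //; first exact: inclusion_AAS_switched.
  exact: decay_jsr D0 dec.
exact: min_qform_common_lyapunov PA.
Qed.
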